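(* There is an absolute constant $C$ such that if $F$ is a graph with $n$ vertices and $m\ge\sqrt{n}$ edges, then $\mathrm{cp}(\overline{F})\le C(mn)^{2/3}$; that is, $\mathrm{cp}(\overline{F})=O((mn)^{2/3})$.
   Context: A clique partition of a graph $G$ is a collection of complete subgraphs of $G$ whose edge sets partition $E(G)$; the clique partition number $\mathrm{cp}(G)$ is the minimum number of cliques in a clique partition of $G$. $\overline{F}$ denotes the complement of the graph $F$ (on the same vertex set). *)

(* Defs.v *)
From HB Require Import structures.
From mathcomp Require Import all_boot all_order all_algebra.
From mathcomp Require Import reals exp.

Set Implicit Arguments.
Unset Strict Implicit.
Unset Printing Implicit Defensive.

Record sgraph (T : finType) := SGraph {
  adj :> rel T;
  adj_sym : symmetric adj;
  adj_irr : irreflexive adj }.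

Section Graphs.
Variable T : finType.
Implicit Types (G : sgraph T) (K : {set T}) (P : {set {set T}}).

Definition edges G : {set {set T}} :=
  [set [set x; y] | x in T, y in T & G x y].

Definition compl_rel G : rel T := fun x y => (x != y) && ~~ G x y.

Lemma compl_sym G : symmetric (compl_rel G).
Proof. by move=> x y; rewrite /compl_rel eq_sym adj_sym. Qed.

Lemma compl_irr G : irreflexive (compl_rel G).
Proof. by move=> x; rewrite /compl_rel eqxx. Qed.

Definition compl G : sgraph T := SGraph (@compl_sym G) (@compl_irr G).

(* A complete subgraph is represented by its vertex set K. *)
Definition clique G K : bool :=
  [forall x in K, forall y in K, (x != y) ==> G x y].

Definition clique_edges K : {set {set T}} :=
  [set E : {set T} | (E \subset K) && (#|E| == 2)].

(* [partition] excludes empty blocks, so every K in P has at least two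
   vertices; as such a K is determined by its edge set, passing to the set of
   edge sets does not identify distinct members of P. *)
Definition clique_partition G P : bool :=
  [forall K in P, clique G K] && partition (clique_edges @: P) (edges G).

(* The default value [edges G] of the minimization is itself a clique
   partition (into single edges), see [clique_partition_edges]. *)
Definition cp G : nat :=
  #|[arg min_(P < edges G | clique_partition G P) #|P|]|.

Lemma edgesP G E :
  reflect (exists x y, G x y /\ E = [set x; y]) (E \in edges G).
Proof.
apply: (iffP imset2P) => [[x y _]|[x [y [Gxy ->]]]].
  by rewrite inE => /andP[_ Gxy] ->; exists x, y.
by exists x y; rewrite ?inE.
Qed.

Lemma edge_card G E : E \in edges G -> #|E| = 2.
Proof.
case/edgesP=> x [y [Gxy ->]]; rewrite cards2; case: eqP Gxy => // ->.
by rewrite adj_irr.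
Qed.

Lemma clique_edges_edge K : #|K| = 2 -> clique_edges K = [set K].
Proof.
move=> K2; apply/setP=> E; rewrite !inE.
apply/andP/eqP => [[sEK /eqP E2]|->]; last by rewrite K2.
by apply/eqP; rewrite eqEcard sEK K2 E2.
Qed.

Lemma clique_edges_inj P :
  set0 \notin clique_edges @: P -> {in P &, injective clique_edges}.
Proof.
have sub K L : clique_edges K != set0 -> clique_edges K = clique_edges L ->
    K \subset L.
  case/set0Pn=> E; rewrite inE => /andP[sEK /eqP E2] eKL.
  have /cards2P[u [v [uv defE]]] : #|E| == 2 by rewrite E2.
  have uK : u \in K by apply: (subsetP sEK); rewrite defE !inE eqxx.
  have vK : v \in K by apply: (subsetP sEK); rewrite defE !inE eqxx orbT.
  have pairL a b : a \in K -> b \in K -> a != b -> a \in L.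
    move=> aK bK ab; have : [set a; b] \in clique_edges L.
      by rewrite -eKL inE cards2 ab subUset !sub1set aK bK.
    by rewrite inE subUset !sub1set => /andP[/andP[]].
  apply/subsetP=> x xK; have [->|xu] := eqVneq x u; first exact: pairL uv.
  exact: pairL xu.
move=> P0 K L KP LP eKL.
have ne M : M \in P -> clique_edges M != set0.
  by move=> MP; apply: contraNneq P0 => <-; apply: imset_f.
by apply/eqP; rewrite eqEsubset (sub _ _ (ne K KP)) // (sub _ _ (ne L LP)).
Qed.

Lemma clique_partition_edges G : clique_partition G (edges G).
Proof.
apply/andP; split.
  apply/forall_inP=> _ /edgesP[x [y [Gxy ->]]].
  apply/forall_inP=> u; rewrite !inE => uxy.
  apply/forall_inP=> v; rewrite !inE => vxy; apply/implyP.
  by case/pred2P: uxy => ->; case/pred2P: vxy => ->; rewrite ?eqxx // adj_sym.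
have -> : clique_edges @: edges G = set1 @: edges G.
  by apply: eq_in_imset => E /edge_card; apply: clique_edges_edge.
apply/and3P; split.
- rewrite cover_imset; apply/eqP/setP=> E; apply/bigcupP/idP.
    by case=> D DG /set1P->.
  by move=> EG; exists E; rewrite ?inE.
- apply/trivIsetP=> _ _ /imsetP[D _ ->] /imsetP[E _ ->] DE.
  by rewrite disjoints1 inE; apply: contraNneq DE => ->.
apply/imsetP=> -[D _ /setP/(_ D)].
by rewrite !inE eqxx.
Qed.

Lemma cp_attained G : exists2 P, clique_partition G P & #|P| = cp G.
Proof.
rewrite /cp; case: arg_minnP; first exact: clique_partition_edges.
by move=> P GP _; exists P.
Qed.

Lemma cp_min G P : clique_partition G P -> cp G <= #|P|.
Proof.
move=> GP; rewrite /cp; case: arg_minnP; first exact: clique_partition_edges.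
by move=> Q _; apply.
Qed.

End Graphs.

(* Main.v *)
Require Import Defs.
From HB Require Import structures.
From mathcomp Require Import all_boot all_order all_algebra.
From mathcomp Require Import finfield.
From mathcomp Require Import reals exp.
From mathcomp Require Import zify ring lra.

Import Order.TTheory GRing.Theory Num.Theory.

(* Let q be a power of 2 with mn < q^3 <= 8mn and k = n/q + 1 <= q.  The n
   vertices are placed on k parabolas y = x^2 + c of the affine plane over the
   field with q elements.  A non-vertical line meets each parabola at most twice
   (in characteristic 2 as well) and a vertical one exactly once, so the
   q^2 + q lines induce a linear space on the vertices whose lines all have at
   most 2k points.  Each line is cut down to a clique of the complement by
   removing the ends of the edges of F inside it; the edges of the complement
   lost in this way number at most 2 * 2k per edge of F, and mk = O(q^2). *)

(** * Clique partitions described by vertex sets, and counting bounds *)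

Section CliquePartitions.
Context {T : finType}.
Implicit Types (G F : sgraph T) (K E : {set T}) (P : {set {set T}}).

Lemma cliqueP G K :
  reflect {in K &, forall x y, x != y -> G x y} (clique G K).
Proof.
apply: (iffP forall_inP) => [H x y xK yK xy|H x xK].
  by have /forall_inP/(_ y yK)/implyP := H x xK; apply.
by apply/forall_inP => y yK; apply/implyP; apply: H.
Qed.

(** Cliques whose edge sets share an edge coincide, so distinct blocks are disjoint; a clique with
    two vertices has an edge, so no block is empty. *)
Lemma clique_partition_intro G P :
    {in P, forall K, clique G K && (1 < #|K|)} ->
    {in edges G, forall E, exists2 K, K \in P & E \subset K} ->
    {in edges G, forall E, {in P &, forall K K',
       E \subset K -> E \subset K' -> K = K'}} ->
  clique_partition G P.
Proof.
move=> cliqP covP uniqP.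
have edgeP K E : K \in P -> E \in clique_edges K -> E \in edges G.
  move=> /cliqP/andP[/cliqueP clK _]; rewrite inE => /andP[sEK].
  case/cards2P=> x [y [xy defE]]; apply/edgesP; exists x, y; split=> //.
  by apply: clK => //; apply: (subsetP sEK); rewrite defE !inE eqxx ?orbT.
apply/andP; split; first by apply/forall_inP => K /cliqP/andP[].
apply/and3P; split.
- rewrite cover_imset; apply/eqP/setP => E; apply/bigcupP/idP.
    by case=> K; apply: edgeP.
  move=> EG; have [K KP sEK] := covP E EG.
  by exists K => //; rewrite inE sEK (edge_card EG).
- apply/trivIsetP => _ _ /imsetP[K KP ->] /imsetP[K' KP' ->].
  apply: contraR => /pred0Pn[E /= /andP[EK EK']].
  have EG := edgeP K E KP EK; rewrite !inE in EK EK'.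
  case/andP: EK => sEK _; case/andP: EK' => sEK' _.
  by rewrite (uniqP E EG K K').
apply/imsetP => -[K /cliqP/andP[_ /card_gt1P[x [y [xK yK xy]]]]].
move/setP/(_ [set x; y]).
by rewrite !inE subUset !sub1set xK yK cards2 xy.
Qed.

Lemma card_edges_le G : #|edges G| <= #|T| ^ 2.
Proof.
rewrite -mulnn -cardX.
apply: leq_trans _ (leq_imset_card (fun p => [set p.1; p.2]) _).
apply/subset_leq_card/subsetP => E /edgesP[x [y [_ ->]]].
by apply/imsetP; exists (x, y).
Qed.

Lemma card_bigcup_le {I : finType} (D : {set I}) (f : I -> {set T}) c :
  {in D, forall i, #|f i| <= c} -> #|\bigcup_(i in D) f i| <= #|D| * c.
Proof.
move=> fc; apply: (@leq_trans (\sum_(i in D) #|f i|)).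
  apply: (big_ind2 (fun (A : {set T}) n => #|A| <= n)) => [|A a B b Aa Bb|//].
    by rewrite cards0.
  by apply: leq_trans (leq_card_setU A B) (leq_add Aa Bb).
by rewrite -sum_nat_const; apply: leq_sum.
Qed.

End CliquePartitions.

(** * Clique partitions of a complement from a linear space *)

Section LinearSpace.
Context {T I : finType} (L : I -> {set T}).
Hypothesis L_cover : forall x y, x != y -> exists i, [set x; y] \subset L i.
Hypothesis L_uniq : forall x y i j, x != y ->
  [set x; y] \subset L i -> [set x; y] \subset L j -> i = j.

(** The trimmed lines [D i] give at most [#|I|] cliques, and each edge lost in trimming becomes its
    own clique. A lost edge joins a removed point of some [L i], which is an end of an edge of [F]
    inside [L i], to a point of [L i]: each edge of [F] allows two choices of the end and at most
    [s] of the other point. *)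
Lemma cp_compl_le (F : sgraph T) s : (forall i, #|L i| <= s) ->
  cp (compl F) <= #|I| + #|edges F| * (2 * s).
Proof.
move=> Ls; pose D i := [set x in L i | [forall y in L i, ~~ F x y]].
pose P1 := [set K in [set D i | i in I] | 1 < #|K|].
pose P2 := [set E in edges (compl F) |
             [exists i, (E \subset L i) && ~~ (E \subset D i)]].
have sDL i : D i \subset L i by apply/subsetP => x; rewrite inE => /andP[].
have edge_uniq E i j : E \in edges (compl F) ->
    E \subset L i -> E \subset L j -> i = j.
  by move=> /edgesP[x [y [/andP[xy _] ->]]]; apply: L_uniq.
have part : clique_partition (compl F) (P1 :|: P2).
  apply: clique_partition_intro => [K|E EG|E EG K K'].
  - case/setUP; rewrite !inE.
      case/andP => /imsetP[i _ ->] ->; rewrite andbT.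
      apply/cliqueP => x y; rewrite !inE.
      move=> /andP[xL /forall_inP xF] /andP[yL _].
      by rewrite /compl /= /compl_rel => ->; apply: xF.
    case/andP=> KG _; rewrite (edge_card KG) andbT.
    case/andP: (clique_partition_edges (compl F)) => /forall_inP clE _.
    exact: clE.
  - have /edgesP[x [y [/andP[xy _] defE]]] := EG.
    have [i] := L_cover _ _ xy; rewrite -defE => sEL.
    have [sED|nsED] := boolP (E \subset D i); last first.
      by exists E => //; rewrite !inE EG; apply/orP; right; apply/existsP;
         exists i; rewrite sEL.
    exists (D i) => //; rewrite !inE imset_f //=.
    by rewrite -(edge_card EG) subset_leq_card.
  (* Only one line contains a given edge, so an edge kept by [D i] is not lost elsewhere. *)
  have in2 i K0 : E \subset D i -> K0 \in P2 -> E \subset K0 -> False.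
    move=> sED; rewrite inE => /andP[KG /existsP[j /andP[sKL nsKD]]] sEK.
    have eEK : E = K0.
      by apply/eqP; rewrite eqEcard sEK (edge_card EG) (edge_card KG).
    move: nsKD; rewrite -eEK; rewrite -eEK in sKL.
    by rewrite (edge_uniq E j i) ?sED // (subset_trans sED).
  case/setUP => [KP1|KP2] /setUP[KP1'|KP2'] sK sK'.
  - move: KP1 KP1' sK sK'; rewrite !inE => /andP[/imsetP[i _ ->] _].
    case/andP => /imsetP[j _ ->] _ si sj.
    by rewrite (edge_uniq E i j) // (subset_trans _ (sDL _)).
  - move: KP1 sK; rewrite !inE => /andP[/imsetP[i _ ->] _] sK.
    by case: (in2 i K').
  - move: KP1' sK'; rewrite !inE => /andP[/imsetP[i _ ->] _] sK'.
    by case: (in2 i K).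
  move: KP2 KP2'; rewrite !inE => /andP[KG _] /andP[KG' _].
  have <- : E = K.
    by apply/eqP; rewrite eqEcard sK (edge_card EG) (edge_card KG).
  by apply/eqP; rewrite eqEcard sK' (edge_card EG) (edge_card KG').
apply: leq_trans (cp_min part) _; apply: leq_trans (leq_card_setU _ _) _.
apply: leq_add.
  apply: leq_trans (subset_leq_card _) (leq_imset_card D I).
  by apply/subsetP => K; rewrite inE => /andP[].
(* For an edge [E] of [F], [M E] is the line through [E], and [B E] contains the lost edges charged
   to [E]. *)
pose M (E : {set T}) := \bigcup_(i | E \subset L i) L i.
pose B (E : {set T}) := \bigcup_(x in E) [set [set x; y] | y in M E].
apply: (@leq_trans #|\bigcup_(E in edges F) B E|).
  apply/subset_leq_card/subsetP => E; rewrite inE.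
  case/andP=> /edgesP[x0 [y0 [_ defE]]] /existsP[i /andP[sEL nsED]].
  (* The ends are named so that [x] is a removed one. *)
  have [x [y [defxy]]] : exists x y, E = [set x; y] /\ x \notin D i.
    move: nsED; rewrite defE subUset !sub1set negb_and => /orP[H|H].
      by exists x0, y0.
    by exists y0, x0; rewrite setUC.
  have [xL yL] : x \in L i /\ y \in L i.
    by move: sEL; rewrite defxy subUset !sub1set => /andP.
  rewrite inE xL /= negb_forall_in => /exists_inP[z zL /negPn Fxz].
  apply/bigcupP; exists [set x; z]; first by apply/edgesP; exists x, z.
  apply/bigcupP; exists x; first by rewrite !inE eqxx.
  rewrite defxy; apply/imset_f/bigcupP; exists i => //.
  by rewrite subUset !sub1set xL zL.
apply: card_bigcup_le => E EF; rewrite -(edge_card EF).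
apply: card_bigcup_le => x _; apply: leq_trans (leq_imset_card _ _) _.
have /edgesP[u [v [Fuv defE]]] := EF.
have uv : u != v by apply: contraTneq Fuv => ->; rewrite adj_irr.
have [i sEi] := L_cover _ _ uv.
suff -> : M E = L i by [].
rewrite /M (big_pred1 i) // => j /=; rewrite defE.
by apply/idP/eqP => [sEj|->//]; apply: (L_uniq _ _ _ _ uv).
Qed.

End LinearSpace.

(** * Lines of the affine plane restricted to parabolas *)

Section Parabolas.
Context {q : finFieldType}.
Local Open Scope ring_scope.

Lemma card_quadratic_roots_le (a b : q) :
  (#|[set x : q | (x ^+ 2 == a * x + b)%R]| <= 2)%N.
Proof.
pose p : {poly q} := 'X^2 - (a *: 'X + b%:P).
have sp : size p = 3%N.
  rewrite /p size_polyDl ?size_polyXn // size_polyN.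
  apply: leq_ltn_trans (size_polyD _ _) _.
  rewrite gtn_max (leq_ltn_trans (size_scale_leq _ _)) ?size_polyX //.
  by rewrite (leq_ltn_trans (size_polyC_leq1 _)).
rewrite cardE -ltnS -sp; apply: max_poly_roots; last exact: enum_uniq.
  by rewrite -size_poly_eq0 sp.
apply/allP => x; rewrite mem_enum inE => /eqP xab.
by rewrite /root /p !hornerE xab subrr.
Qed.

(** The pair [(x, j)] stands for the point (x, x^2 + g j); [inl (a, b)] is the line y = a x + b and
    [inr a] the vertical line x = a. *)
Definition parabola_line {k : nat} (g : 'I_k -> q) (i : q * q + q) :
    {set q * 'I_k} :=
  match i with
  | inl ab => [set p | p.1 ^+ 2 + g p.2 == ab.1 * p.1 + ab.2]
  | inr a => [set p | p.1 == a]
  end.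

Context {k : nat} (g : 'I_k -> q).

Lemma card_parabola_line i : (#|parabola_line g i| <= 2 * k)%N.
Proof.
have -> : (2 * k = #|[set: 'I_k]| * 2)%N by rewrite cardsT card_ord mulnC.
pose f (j : 'I_k) := [set (x, j) | x in [set x | (x, j) \in parabola_line g i]].
apply: (@leq_trans #|\bigcup_(j in setT) f j|).
  apply/subset_leq_card/subsetP => -[x j] H.
  by apply/bigcupP; exists j => //; apply/imset_f; rewrite inE.
apply: card_bigcup_le => j _; apply: leq_trans (leq_imset_card _ _) _.
case: i {f} => [[a b]|a] /=; last first.
  have -> : [set x | (x, j) \in [set p : q * 'I_k | p.1 == a]] = [set a].
    by apply/setP => x; rewrite !inE.
  by rewrite cards1.
(* On parabola [j] the line becomes x^2 = a x + (b - g j). *)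
apply: leq_trans _ (card_quadratic_roots_le a (b - g j)).
apply/subset_leq_card/subsetP => x; rewrite !inE /= addrA => /eqP <-.
by rewrite addrK.
Qed.

Hypothesis g_inj : injective g.

Lemma parabola_line_cover p p' : p != p' ->
  exists i, [set p; p'] \subset parabola_line g i.
Proof.
case: p p' => [x j] [x' j'] pp'; have [->|xx'] := eqVneq x x'.
  by exists (inr x'); rewrite subUset !sub1set !inE /= eqxx.
(* The slope of the secant through the two points. *)
pose a := (x ^+ 2 + g j - (x' ^+ 2 + g j')) / (x - x').
exists (inl (a, x ^+ 2 + g j - a * x)).
rewrite subUset !sub1set !inE /= [a * x + _]addrC subrK eqxx /=.
have xx'0 : x - x' != 0 by rewrite subr_eq0.
by apply/eqP; rewrite /a; field.
Qed.

Lemma parabola_line_uniq p p' i i' : p != p' ->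
  [set p; p'] \subset parabola_line g i ->
  [set p; p'] \subset parabola_line g i' -> i = i'.
Proof.
(* A non-vertical line has one point above each abscissa, and that point is on one parabola only
   since [g] is injective. *)
have vert (x : q) j j' a b : x ^+ 2 + g j = a * x + b ->
    x ^+ 2 + g j' = a * x + b -> (x, j) != (x, j') -> False.
  by move=> <- /addrI/g_inj ->; rewrite eqxx.
case: p p' => [x j] [x' j'] pp'; rewrite !subUset !sub1set.
case: i => [[a b]|a]; case: i' => [[a' b']|a']; rewrite !inE /=;
  case/andP => /eqP e1 /eqP e2 /andP[/eqP e3 /eqP e4].
- have [xx'|xx'] := eqVneq x x'.
    by subst x'; case: (vert x j j' a b).
  have xx'0 : x - x' != 0 by rewrite subr_eq0.
  have aa' : a = a'.
    apply: (mulIf xx'0).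
    transitivity (x ^+ 2 + g j - (x' ^+ 2 + g j')).
      by rewrite e1 e2; ring.
    by rewrite e3 e4; ring.
  by congr (inl (_, _)) => //; apply: (@addrI _ (a * x)); rewrite -e1 e3 aa'.
- by subst x x'; case: (vert a' j j' a b).
- by subst x x'; case: (vert a j j' a' b').
by rewrite -e1 -e3.
Qed.

End Parabolas.

(** * Placing the vertices and choosing the field *)

(** The first bound provides [k] distinct constants for the parabolas, the second an injection [h]
    of the vertices into their points; the lines are pulled back along [h]. *)
Lemma cp_compl_le_parabolas (q : finFieldType) k (T : finType) (F : sgraph T) :
  k <= #|q| -> #|T| <= #|q| * k ->
  cp (compl F) <= #|q| ^ 2 + #|q| + #|edges F| * (4 * k).
Proof.
move=> kq Tqk.
pose g (j : 'I_k) : q := enum_val (widen_ord kq j).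
have g_inj : injective g.
  by move=> i j /enum_val_inj /(congr1 val) /= ij; apply: val_inj.
have Tle : #|T| <= #|{: q * 'I_k}| by rewrite card_prod card_ord.
pose h (t : T) : q * 'I_k := enum_val (widen_ord Tle (enum_rank t)).
have h_inj : injective h.
  by move=> s t /enum_val_inj /(congr1 val) /= st; apply/enum_rank_inj/val_inj.
pose L i := [set t | h t \in parabola_line g i].
have LE x y i : ([set x; y] \subset L i) =
    ([set h x; h y] \subset parabola_line g i).
  by rewrite !subUset !sub1set !inE.
rewrite -mulnn -card_prod -card_sum -[4]/(2 * 2) -(mulnA 2).
apply: (@cp_compl_le _ _ L).
- move=> x y xy; have hxy : h x != h y by rewrite (inj_eq h_inj).
  by have [i Li] := parabola_line_cover g _ _ hxy; exists i; rewrite LE.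
- move=> x y i j xy; rewrite !LE; apply: parabola_line_uniq => //.
  by rewrite (inj_eq h_inj).
move=> i; rewrite -(card_imset _ h_inj).
apply: leq_trans _ (card_parabola_line g i).
by apply/subset_leq_card/subsetP => _ /imsetP[t + ->]; rewrite inE.
Qed.

(* q is taken to be a power of 2 only because those are easy to locate between
   (m n)^(1/3) and 2 (m n)^(1/3). *)
Lemma cp_compl_le_pow2 (T : finType) (F : sgraph T) :
    0 < #|T| -> #|T| <= #|edges F| ^ 2 ->
  exists2 q, cp (compl F) <= 10 * q ^ 2 & q ^ 3 <= 8 * (#|edges F| * #|T|).
Proof.
have := card_edges_le F; set n := #|T|; set m := #|edges F| => mn n0 nm.
have N0 : 0 < m * n by nia.
have /andP[le_l lt_l] := @trunc_log_bounds 8 (m * n) isT N0.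
set l := trunc_log 8 _ in le_l lt_l; pose q := 2 ^ l.+1.
have q3 : q ^ 3 = 8 ^ l.+1 by rewrite /q -expnM mulnC expnM.
exists q; last by rewrite q3 expnS leq_mul2l.
have [Fq _ cardFq] := @pPrimePowerField 2 l.+1 isT isT.
rewrite -/q in cardFq; rewrite -q3 in lt_l.
have q0 : 0 < q by rewrite expn_gt0.
(* From n <= m^2 follows n^3 <= (m n)^2 < q^6; the next bound uses m <= n^2 in the same way. *)
have nq : n < q ^ 2.
  rewrite -(ltn_exp2r _ _ (isT : 0 < 3)) -expnM (expnM q 3 2).
  apply: leq_ltn_trans (_ : (m * n) ^ 2 < _); last by rewrite ltn_exp2r.
  by rewrite expnMn (expnS n 2) leq_mul2r nm orbT.
have mq : m < q ^ 2.
  rewrite -(ltn_exp2r _ _ (isT : 0 < 3)) -expnM (expnM q 3 2).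
  apply: leq_ltn_trans (_ : (m * n) ^ 2 < _); last by rewrite ltn_exp2r.
  by rewrite expnMn (expnSr m 2) leq_mul2l mn orbT.
pose k := (n %/ q).+1.
have kq : k <= q by rewrite /k ltn_divLR // mulnn.
have nqk : n <= q * k by rewrite mulnC ltnW // ltn_ceil.
have mk : m * (n %/ q) <= q ^ 2.
  rewrite -(leq_pmul2r q0) -mulnA -expnSr.
  by apply: leq_trans (ltnW lt_l); rewrite leq_mul2l leq_trunc_div orbT.
have := @cp_compl_le_parabolas Fq k T F; rewrite cardFq => /(_ kq nqk).
(* The terms q, 4 m (n / q) and 4 m are at most q^2, 4 q^2 and 4 q^2, which with q^2 makes 10
   q^2. *)
move/leq_trans; apply; rewrite -/m /k; move: mk mq q0.
by rewrite mulnCA mulnS; move: (m * (n %/ q)) => x; nia.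
Qed.

(** * Passage to real exponents *)

Local Open Scope ring_scope.

(** Both sides of the hypothesis are raised to the power 2/3, and 8 = 2^3 yields the factor 4. *)
Lemma sqr_le_powR (R : realType) (q N : nat) :
  (q ^ 3 <= 8 * N)%N -> (q ^ 2)%:R <= 4 * (N%:R `^ (2%:R / 3%:R)) :> R.
Proof.
move=> qN.
have cube (a : R) : 0 <= a -> (a ^+ 3) `^ (2%:R / 3%:R) = a ^+ 2.
  move=> a0; rewrite -(powR_mulrn 3) // -powRrM.
  by rewrite mulrC divfK ?powR_mulrn // pnatr_eq0.
have -> : 4 = 2 ^+ 2 :> R by rewrite -natrX.
rewrite natrX -(cube q%:R) // -(cube 2) // -powRM ?exprn_ge0 //.
apply: ge0_ler_powR; rewrite ?nnegrE ?exprn_ge0 ?mulr_ge0 ?invr_ge0 //.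
by rewrite -!natrX -natrM ler_nat.
Qed.

Theorem theorem6p2 (R : realType) :
  exists C : R, forall (n m : nat) (T : finType) (F : sgraph T),
    #|T| = n -> #|edges F| = m ->
    Num.sqrt n%:R <= m%:R :> R ->
    (cp (compl F))%:R <= C * ((m * n)%:R `^ (2%:R / 3%:R)).
Proof.
(* 40 = 10 * 4: the clique count is at most 10 q^2, and q^2 is at most 4 (m n)^(2/3). *)
exists 40 => n m T F Tn Fm nm.
have nm2 : (n <= m ^ 2)%N.
  rewrite -(ler_nat R) natrX -[leLHS]sqr_sqrtr ?ler0n //.
  by rewrite lerXn2r ?nnegrE ?sqrtr_ge0 ?ler0n.
(* Without vertices there are no edges, and the partition into single edges is empty. *)
have [n0|n0] := posnP n.
  have cp0 : (cp (compl F) <= 0)%N.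
    apply: leq_trans (cp_min (clique_partition_edges (compl F))) _.
    by apply: leq_trans (card_edges_le _) _; rewrite Tn n0.
  move: cp0; rewrite leqn0 => /eqP ->.
  by rewrite mulr_ge0 // powR_ge0.
have [q cpq q3] : exists2 q, (cp (compl F) <= 10 * q ^ 2)%N &
    (q ^ 3 <= 8 * (m * n))%N.
  by have := cp_compl_le_pow2 T F; rewrite Tn Fm; apply.
have := sqr_le_powR R q _ q3.
have : (cp (compl F))%:R <= 10 * (q ^ 2)%:R :> R by rewrite -natrM ler_nat.
move: (_ `^ _) => X; lra.
Qed.
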